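(* If a perfect Euler brick exists, then for a parameter $s$ corresponding to it, with $c(s) = \frac{s^4-6s^2+1}{(1+s^2)^2}$ and $A(s) = 2-4c(s)^2$, the genus-3 hyperelliptic curve $$C_A\colon\ w^2 = \lambda^8 + A(s)\,\lambda^4 + 1$$ has a non-degenerate rational point, i.e. there exist $\lambda, w\in\mathbb{Q}$ with $\lambda\notin\{0,1,-1\}$ satisfying this equation.
   Context: A perfect Euler brick is a triple of positive integers $(e_1,e_2,e_3)$ such that $e_1^2+e_2^2$, $e_1^2+e_3^2$, $e_2^2+e_3^2$ and $e_1^2+e_2^2+e_3^2$ are all squares of positive integers. A Euclid pair is a pair of coprime integers $a>b>0$ with $a-b$ odd. Any perfect Euler brick has, after reordering and up to a common positive rational factor, edges of the form $$e_1 = U_1U_2,\quad e_2 = V_1U_2,\quad e_3 = U_1V_2,$$ where $(a,b)$ and $(m,n)$ are Euclid pairs, $U_1=a^2-b^2$, $V_1=2ab$, $U_2=m^2-n^2$, $V_2=2mn$. The parameter $s$ corresponding to the brick is $s=a/b$ for such a representation. A rational point on $C_A$ means an affine point $(\lambda,w)\in\mathbb{Q}^2$; it is degenerate if $\lambda\in\{0,1,-1\}$ and non-degenerate otherwise. *)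

(* Defs.v *)
From mathcomp Require Import all_boot all_order all_algebra.
Set Implicit Arguments.
Unset Strict Implicit.
Unset Printing Implicit Defensive.
Import Order.TTheory GRing.Theory Num.Theory.
Local Open Scope ring_scope.

Definition pos_square (x : int) : Prop := exists2 d : int, 0 < d & x = d ^+ 2.

Definition perfect_euler_brick (e1 e2 e3 : int) : Prop :=
  [/\ 0 < e1, 0 < e2 & 0 < e3] /\
  [/\ pos_square (e1 ^+ 2 + e2 ^+ 2),
      pos_square (e1 ^+ 2 + e3 ^+ 2),
      pos_square (e2 ^+ 2 + e3 ^+ 2)
    & pos_square (e1 ^+ 2 + e2 ^+ 2 + e3 ^+ 2)].

Definition euclid_pair (a b : int) : bool :=
  [&& 0 < b, b < a, coprimez a b & odd `|a - b|%N].

Definition euclid_U (a b : int) : int := a ^+ 2 - b ^+ 2.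

Definition euclid_V (a b : int) : int := 2 * a * b.

(* The edges are compared in [rat] as multisets: [perm_eq] expresses
   "after reordering", and [r] is the common positive rational factor. *)
Definition brick_representation (e1 e2 e3 a b m n : int) : Prop :=
  [/\ euclid_pair a b, euclid_pair m n
    & exists2 r : rat, 0 < r &
      perm_eq [:: e1%:~R; e2%:~R; e3%:~R : rat]
        [:: r * (euclid_U a b * euclid_U m n)%:~R;
            r * (euclid_V a b * euclid_U m n)%:~R;
            r * (euclid_U a b * euclid_V m n)%:~R]].

Definition brick_parameter (e1 e2 e3 : int) (s : rat) : Prop :=
  exists a b m n : int,
    brick_representation e1 e2 e3 a b m n /\ s = a%:~R / b%:~R.

Definition c_of (s : rat) : rat :=
  (s ^+ 4 - 6 * s ^+ 2 + 1) / (1 + s ^+ 2) ^+ 2.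

Definition A_of (s : rat) : rat := 2 - 4 * c_of s ^+ 2.

Definition on_curve (A lambda w : rat) : Prop :=
  w ^+ 2 = lambda ^+ 8 + A * lambda ^+ 4 + 1.

Definition degenerate (lambda : rat) : bool := lambda \in [:: 0; 1; -1].

(* Main.v *)
Require Import Defs.
From mathcomp Require Import all_boot all_order all_algebra.
From mathcomp Require Import ring lra zify.
Set Implicit Arguments.
Unset Strict Implicit.
Unset Printing Implicit Defensive.
Import Order.TTheory GRing.Theory Num.Theory.
Local Open Scope ring_scope.

(** For the curve: write [l - l^-1 = 2 * k / P] with [P ^+ 2 = e1 ^+ 2 + e2 ^+ 2].
    Since [c = (e1 ^+ 2 - e2 ^+ 2) / P ^+ 2], the equation of [C_A] becomes
    [w ^+ 2 = 16 * l ^+ 4 * (k ^+ 2 + e1 ^+ 2) * (k ^+ 2 + e2 ^+ 2) / P ^+ 4],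
    and [l] is rational as soon as [k ^+ 2 + P ^+ 2] is a square.  A perfect
    brick provides the solution [k = e3], so [l = (e3 + R) / P] where [R] is the
    space diagonal.

    For the representation: divide the brick by the gcd of its edges and call
    [x] an odd edge.  For another edge [y] and the face diagonal [z], the
    reduced fraction [a / b = (x + z) / y] satisfies
    [x * (2 * a * b) = y * (a ^+ 2 - b ^+ 2)]; if [a] and [b] were both odd, the
    left side would be 2 modulo 4 and the right side divisible by 8. *)

Lemma perm_eq3 (T : eqType) (x y z u v w : T) :
  perm_eq [:: x; y; z] [:: u; v; w] ->
  [\/ [/\ x = u, y = v & z = w], [/\ x = u, y = w & z = v],
      [/\ x = v, y = u & z = w] | [\/ [/\ x = v, y = w & z = u],
      [/\ x = w, y = u & z = v] | [/\ x = w, y = v & z = u]]].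
Proof.
(* A permutation of three entries amounts to a list of indices, one of the six computed here. *)
case/(perm_iotaP u) => Is; rewrite -mem_permutations.
have -> : permutations (iota 0 (size [:: u; v; w])) =
  [:: [:: 1; 0; 2]; [:: 0; 1; 2]; [:: 2; 0; 1]; [:: 0; 2; 1];
      [:: 1; 2; 0]; [:: 2; 1; 0]]%N by vm_compute.
rewrite !inE !orbA; do 5?[case/orP]; move/eqP=> -> /= [-> -> ->];
  by auto using And3, Or41, Or42, Or43, Or44, Or31, Or32, Or33.
Qed.

(** * The rational point on the curve *)

(** With [A = 2 - 4 * c ^+ 2] the octic factors as [(l ^+ 4 + 1 - 2 * c * l ^+ 2) * (l ^+ 4 + 1 + 2
    * c * l ^+ 2)]. Both factors are squares, coming from the face diagonals [q] and [p]
    respectively. *)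
Lemma curve_point (x y z d p q r s : rat) :
  0 < z -> 0 < d -> 0 < r ->
  x ^+ 2 + y ^+ 2 = d ^+ 2 -> x ^+ 2 + z ^+ 2 = p ^+ 2 ->
  y ^+ 2 + z ^+ 2 = q ^+ 2 -> x ^+ 2 + y ^+ 2 + z ^+ 2 = r ^+ 2 ->
  c_of s = (x ^+ 2 - y ^+ 2) / d ^+ 2 ->
  exists lambda w : rat, on_curve (A_of s) lambda w /\ ~~ degenerate lambda.
Proof.
move=> z0 d0 r0 Ed Ep Eq Er Ec.
have dn0 : d != 0 by rewrite gt_eqF.
(* From [r ^+ 2 = d ^+ 2 + z ^+ 2]. It yields [lambda > 1], which excludes all degenerate values at
   once. *)
have dr : d < r by nra.
exists ((z + r) / d), (4 * ((z + r) / d) ^+ 2 * p * q / d ^+ 2).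
have l1 : 1 < (z + r) / d by rewrite ltr_pdivlMr //; lra.
split; last by rewrite /degenerate !inE; apply/negP => /or3P[] /eqP; lra.
rewrite /on_curve /A_of Ec.
set l := _ / d in l1 *.
have El : l ^+ 2 - 1 = 2 * z / d * l.
  apply: (mulfI (expf_neq0 2 dn0)); rewrite /l.
  transitivity ((z + r) ^+ 2 - d ^+ 2); first by field.
  transitivity (2 * z * (z + r)); last by field.
  have -> : d ^+ 2 = r ^+ 2 - z ^+ 2 by rewrite -Er -Ed; ring.
  ring.
(* By [El] the left side is [l ^+ 2 * (4 * z ^+ 2 / d ^+ 2 + 2 - 2 * c)], and
   [2 - 2 * c = 4 * y ^+ 2 / d ^+ 2]. The opposite sign, in [Epl], produces [x] instead of [y]. *)
have Em : l ^+ 4 + 1 - 2 * ((x ^+ 2 - y ^+ 2) / d ^+ 2) * l ^+ 2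
  = 4 * q ^+ 2 / d ^+ 2 * l ^+ 2.
  have -> : l ^+ 4 + 1 = (l ^+ 2 - 1) ^+ 2 + 2 * l ^+ 2 by ring.
  rewrite El -Eq.
  have -> : 2 * l ^+ 2 = 2 * (d ^+ 2) / d ^+ 2 * l ^+ 2 by field.
  by rewrite -[in 2 * (d ^+ 2)]Ed; field.
have Epl : l ^+ 4 + 1 + 2 * ((x ^+ 2 - y ^+ 2) / d ^+ 2) * l ^+ 2
  = 4 * p ^+ 2 / d ^+ 2 * l ^+ 2.
  have -> : l ^+ 4 + 1 = (l ^+ 2 - 1) ^+ 2 + 2 * l ^+ 2 by ring.
  rewrite El -Ep.
  have -> : 2 * l ^+ 2 = 2 * (d ^+ 2) / d ^+ 2 * l ^+ 2 by field.
  by rewrite -[in 2 * (d ^+ 2)]Ed; field.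
transitivity ((4 * p ^+ 2 / d ^+ 2 * l ^+ 2) * (4 * q ^+ 2 / d ^+ 2 * l ^+ 2)).
  by field.
by rewrite -Em -Epl; field.
Qed.

(** The denominators agree because [U ^+ 2 + V ^+ 2 = (a ^+ 2 + b ^+ 2) ^+ 2]; thus [c] is the
    cosine of twice the angle with tangent [V / U]. *)
Lemma c_of_euclid (a b : int) : euclid_pair a b ->
  c_of (a%:~R / b%:~R) =
    ((euclid_U a b)%:~R ^+ 2 - (euclid_V a b)%:~R ^+ 2) /
    ((euclid_U a b)%:~R ^+ 2 + (euclid_V a b)%:~R ^+ 2).
Proof.
case/and4P=> b0 ab _ _; rewrite /c_of /euclid_U /euclid_V.
have B0 : 0 < b%:~R :> rat by rewrite ltr0z.
have A0 : 0 < a%:~R :> rat by rewrite ltr0z; lia.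
rewrite !(rmorphB, rmorphM, rmorphXn) /=.
move: (a%:~R) (b%:~R) A0 B0 => A B A0 B0.
have AB : 0 < A ^+ 2 + B ^+ 2 by rewrite addr_gt0 ?exprn_gt0.
have ABn : A ^+ 2 + B ^+ 2 != 0 by rewrite gt_eqF.
have -> : (A ^+ 2 - B ^+ 2) ^+ 2 + (2%:~R * A * B) ^+ 2 = (A ^+ 2 + B ^+ 2) ^+ 2.
  by ring.
field.
by rewrite ABn gt_eqF.
Qed.

(** Stated over [rat], since represented edges carry a rational factor [r]. *)
Definition brick_edges (x y z : rat) : Prop :=
  [/\ 0 < x, 0 < y & 0 < z] /\
  [/\ exists2 d : rat, 0 < d & x ^+ 2 + y ^+ 2 = d ^+ 2,
      exists2 d : rat, 0 < d & x ^+ 2 + z ^+ 2 = d ^+ 2,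
      exists2 d : rat, 0 < d & y ^+ 2 + z ^+ 2 = d ^+ 2
    & exists2 d : rat, 0 < d & x ^+ 2 + y ^+ 2 + z ^+ 2 = d ^+ 2].

Lemma brick_edges_rat (e1 e2 e3 : int) :
  perfect_euler_brick e1 e2 e3 -> brick_edges e1%:~R e2%:~R e3%:~R.
Proof.
case=> -[h1 h2 h3] [[d1 p1 E1] [d2 p2 E2] [d3 p3 E3] [d4 p4 E4]].
rewrite /brick_edges !ltr0z; split=> //.
by split; [exists d1%:~R | exists d2%:~R | exists d3%:~R | exists d4%:~R];
  rewrite ?ltr0z // -!rmorphXn /= -?E1 -?E2 -?E3 -?E4 !rmorphD.
Qed.

Lemma brick_edges_perm (x y z u v w : rat) :
  perm_eq [:: x; y; z] [:: u; v; w] -> brick_edges x y z -> brick_edges u v w.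
Proof.
(* Two adjacent transpositions generate all six orders. *)
have C12 (x1 y1 z1 : rat) : brick_edges x1 y1 z1 -> brick_edges y1 x1 z1.
  case=> -[? ? ?] [? ? ? ?]; do !split=> //; first by rewrite addrC.
  by rewrite [y1 ^+ 2 + _]addrC.
have C23 (x1 y1 z1 : rat) : brick_edges x1 y1 z1 -> brick_edges x1 z1 y1.
  case=> -[? ? ?] [? ? ? ?]; do !split=> //; first by rewrite addrC.
  by rewrite addrAC.
case/perm_eq3=> [||| []] [-> -> ->]; auto.
Qed.

Lemma brick_point (e1 e2 e3 : int) (s : rat) :
  perfect_euler_brick e1 e2 e3 -> brick_parameter e1 e2 e3 s ->
  exists lambda w : rat, on_curve (A_of s) lambda w /\ ~~ degenerate lambda.
Proof.
move=> /brick_edges_rat brick [a [b [m [n [[eab emn [r r0 /brick_edges_perm]]]]]]].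
move=> /(_ brick) {brick} brick Es.
case: brick => -[x0 y0 z0] [[d d0 Ed] [p _ Ep] [q _ Eq] [t t0 Et]].
apply: (curve_point z0 d0 t0 Ed Ep Eq Et).
(* The first two represented edges share the factor [r * euclid_U m n], which cancels from the
   quotient. *)
rewrite Es c_of_euclid // -Ed (intrM _ (euclid_U a b)) (intrM _ (euclid_V a b)).
have rn0 : r != 0 by rewrite gt_eqF.
move: x0; rewrite intrM pmulr_rgt0 // => /lt0r_neq0; rewrite mulf_eq0 negb_or.
case/andP=> Un0 U2n0.
move: (euclid_V a b)%:~R (euclid_U a b)%:~R Un0 => V U Un0.
have D0 : U ^+ 2 + V ^+ 2 != 0.
  by rewrite paddr_eq0 ?sqr_ge0 // negb_and expf_neq0.
field.
rewrite D0 andbT.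
have -> : forall W, (r * (U * W)) ^+ 2 + (r * (V * W)) ^+ 2 =
    r ^+ 2 * W ^+ 2 * (U ^+ 2 + V ^+ 2) by move=> W; ring.
by rewrite !mulf_neq0 ?expf_neq0.
Qed.

(** * Existence of a representation by Euclid pairs *)

(** [z] is rational because it will be a diagonal divided by the gcd of the edges. Oddness of [x] is
    what forces [a - b] to be odd. *)
Lemma odd_leg_euclid_pair (x y : int) (z : rat) :
  0 < x -> 0 < y -> 0 < z -> odd `|x| ->
  x%:~R ^+ 2 + y%:~R ^+ 2 = z ^+ 2 ->
  exists a b : int, euclid_pair a b /\ x * euclid_V a b = y * euclid_U a b.
Proof.
move=> x0 y0 z0 xodd Ez.
have X0 : 0 < x%:~R :> rat by rewrite ltr0z.
have Y0 : 0 < y%:~R :> rat by rewrite ltr0z.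
set t : rat := (x%:~R + z) / y%:~R.
(* Here [x + z > y] because [z > y]; this becomes [b < a]. *)
have t1 : 1 < t by rewrite ltr_pdivlMr // mul1r; nra.
have Et : x%:~R * (2 * t) = y%:~R * (t ^+ 2 - 1).
  have Ey : y%:~R ^+ 2 = z ^+ 2 - x%:~R ^+ 2 :> rat by rewrite -Ez; ring.
  apply: (mulfI (lt0r_neq0 Y0)).
  transitivity (2 * x%:~R * (x%:~R + z)); first by rewrite /t; field; exact: lt0r_neq0.
  transitivity ((x%:~R + z) ^+ 2 - y%:~R ^+ 2); first by rewrite Ey; ring.
  by rewrite /t; field; exact: lt0r_neq0.
have b0 := denq_gt0 t.
have E : x * euclid_V (numq t) (denq t) = y * euclid_U (numq t) (denq t).
  apply/(@intr_inj rat); rewrite /euclid_V /euclid_U.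
  rewrite !(rmorphB, rmorphM, rmorphXn) /=.
  have B0 : (denq t)%:~R != 0 :> rat by rewrite intr_eq0 gt_eqF.
  have -> : (numq t)%:~R = t * (denq t)%:~R by rewrite -{2}(divq_num_den t) divfK.
  transitivity (x%:~R * (2 * t) * (denq t)%:~R ^+ 2); first by ring.
  by rewrite Et; ring.
have ab : denq t < numq t.
  by rewrite -(ltr_int rat) -[ltLHS]mul1r -ltr_pdivlMr ?ltr0z // divq_num_den.
have cab : coprimez (numq t) (denq t) by exact: coprime_num_den.
exists (numq t), (denq t); split=> //.
apply/and4P; split=> //.
move: E ab cab b0; move: (numq t) (denq t) => a b.
rewrite /euclid_V /euclid_U => E ab cab b0.
apply/negPn/negP => oab.
(* As [a - b] is even, the alternative is that both are even, against coprimality. *)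
have : odd `|a| && odd `|b|.
  apply/negPn/negP => nodd.
  have /andP[/dvdzP[a' Ea] /dvdzP[b' Eb]] : (2 %| a)%Z && (2 %| b)%Z.
    by move: oab nodd; lia.
  have : (2 %| gcdz a b)%Z by rewrite dvdz_gcd Ea Eb !dvdz_mull.
  by rewrite (eqP cab).
case/andP=> oa ob.
have [k Ea] : exists k, a = 2 * k + 1 by exists (a %/ 2)%Z; lia.
have [l Eb] : exists l, b = 2 * l + 1 by exists (b %/ 2)%Z; lia.
(* Half of [a ^+ 2 - b ^+ 2] is still even for odd [a] and [b], whereas [x * a * b] is odd. *)
have {}E : x * a * b = 2 * (y * (k ^+ 2 + k - l ^+ 2 - l)).
  apply: (mulfI (isT : 2 != 0 :> int)).
  transitivity (x * (2 * a * b)); first by ring.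
  by rewrite E Ea Eb; ring.
have : odd `|x * a * b| by rewrite !abszM !oddM xodd oa ob.
by rewrite E abszM oddM.
Qed.

(** If all quotients by the gcd [g] were even, [2 * g] would divide every edge and hence [g]. *)
Lemma brick_edges_gcd (e1 e2 e3 : int) : 0 < e1 ->
  exists g f1 f2 f3 : int,
  [/\ 0 < g, e1 = g * f1, e2 = g * f2, e3 = g * f3
    & [|| odd `|f1|, odd `|f2| | odd `|f3|]].
Proof.
move=> e10; set g := gcdz e1 (gcdz e2 e3).
have g0 : 0 < g.
  by rewrite /g /gcdz ltz_nat gcdn_gt0 absz_gt0 gt_eqF.
have /dvdzP[f1 E1] : (g %| e1)%Z by rewrite dvdz_gcdl.
have /dvdzP[f2 E2] : (g %| e2)%Z by rewrite (dvdz_trans (dvdz_gcdr _ _)) ?dvdz_gcdl.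
have /dvdzP[f3 E3] : (g %| e3)%Z by rewrite (dvdz_trans (dvdz_gcdr _ _)) ?dvdz_gcdr.
exists g, f1, f2, f3; split; rewrite 1?mulrC //.
apply/negPn/negP => nodd.
have /and3P[d1 d2 d3] : [&& (2 %| f1)%Z, (2 %| f2)%Z & (2 %| f3)%Z].
  by move: nodd; lia.
have gdvd (e f : int) : e = f * g -> (2 %| f)%Z -> (2 * g %| e)%Z.
  by move=> -> ?; rewrite dvdz_mul.
have : (2 * g %| g)%Z.
  by rewrite {2}/g !dvdz_gcd (gdvd _ _ E1) // (gdvd _ _ E2) // (gdvd _ _ E3).
case/dvdzP=> k; rewrite mulrA -[LHS]mul1r => /(mulIf (lt0r_neq0 g0)).
by lia.
Qed.

Lemma brick_representation_perm (e1 e2 e3 f1 f2 f3 a b m n : int) :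
  perm_eq [:: e1; e2; e3] [:: f1; f2; f3] ->
  brick_representation f1 f2 f3 a b m n -> brick_representation e1 e2 e3 a b m n.
Proof.
move=> /(perm_map (fun x : int => x%:~R : rat)) /= ef [eab emn [r r0 rf]].
by split=> //; exists r; rewrite // (perm_trans ef).
Qed.

(** The odd edge is the leg common to two right triangles, so [y / x = V1 / U1] and
    [z / x = V2 / U2]; the first edge then fixes [r] as [g * x / (U1 * U2)]. *)
Lemma odd_edge_representation (g x y z : int) :
  0 < g -> odd `|x| -> brick_edges (g * x)%:~R (g * y)%:~R (g * z)%:~R ->
  exists a b m n, brick_representation (g * x) (g * y) (g * z) a b m n.
Proof.
move=> g0 xodd [[]]; rewrite !ltr0z !pmulr_rgt0 // => x0 y0 z0.
case=> -[d d0 Ed] [p p0 Ep] _ _.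
have G0 : 0 < g%:~R :> rat by rewrite ltr0z.
have leg (v : int) (e : rat) : 0 < v -> 0 < e ->
    (g * x)%:~R ^+ 2 + (g * v)%:~R ^+ 2 = e ^+ 2 ->
    exists a b : int, euclid_pair a b /\ x * euclid_V a b = v * euclid_U a b.
  move=> v0 e0 Ee.
  apply: (@odd_leg_euclid_pair x v (e / g%:~R)); rewrite ?divr_gt0 //.
  rewrite expr_div_n -Ee !intrM; field; exact: lt0r_neq0.
have [a [b [eab Eab]]] := leg _ _ y0 d0 Ed.
have [m [n [emn Emn]]] := leg _ _ z0 p0 Ep.
have U0 (u v : int) : euclid_pair u v -> 0 < (euclid_U u v)%:~R :> rat.
  by case/and4P=> v0 uv _ _; rewrite ltr0z /euclid_U; nia.
exists a, b, m, n; split=> //.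
have {}Eab := congr1 (fun i : int => i%:~R : rat) Eab.
have {}Emn := congr1 (fun i : int => i%:~R : rat) Emn.
move: (U0 _ _ eab) (U0 _ _ emn) => U1 U2.
exists ((g * x)%:~R / (euclid_U a b * euclid_U m n)%:~R).
  by rewrite divr_gt0 // ?ltr0z ?mulr_gt0 // -(ltr0z rat).
move: Eab Emn; rewrite 4!intrM => Eab Emn.
rewrite !(intrM _ g) !(intrM _ (euclid_U a b)) (intrM _ (euclid_V a b)).
move: (lt0r_neq0 U1) (lt0r_neq0 U2) Eab Emn => {U1 U2}.
move: (euclid_U a b)%:~R (euclid_V a b)%:~R => U1 V1.
move: (euclid_U m n)%:~R (euclid_V m n)%:~R => U2 V2 U1n U2n Eab Emn.
set l1 := [:: _; _; _]; set l2 := [:: _; _; _].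
suff -> : l1 = l2 by [].
rewrite /l1 /l2; congr [:: _; _; _].
- by field; rewrite U1n U2n.
- have -> : y%:~R = x%:~R * V1 / U1 by rewrite Eab mulfK.
  by field; rewrite U1n U2n.
- have -> : z%:~R = x%:~R * V2 / U2 by rewrite Emn mulfK.
  by field; rewrite U1n U2n.
Qed.

Lemma brick_parameter_exists (e1 e2 e3 : int) :
  perfect_euler_brick e1 e2 e3 -> exists s : rat, brick_parameter e1 e2 e3 s.
Proof.
move=> brick; suff [a [b [m [n E]]]] :
    exists a b m n, brick_representation e1 e2 e3 a b m n.
  by exists (a%:~R / b%:~R), a, b, m, n.
have [[e10 _ _] _] := brick; move/brick_edges_rat: brick.
have [g [f1 [f2 [f3 [g0 -> -> ->]]]]] := brick_edges_gcd e2 e3 e10.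
move=> fodd brick.
(* Representations ignore the order of the edges, so the odd one may be moved to the front. *)
have reduce (x y z : int) :
    perm_eq [:: g * x; g * y; g * z] [:: g * f1; g * f2; g * f3] -> odd `|x| ->
    exists a b m n, brick_representation (g * f1) (g * f2) (g * f3) a b m n.
  rewrite perm_sym => fx xodd.
  have /= fxQ := perm_map (fun i : int => i%:~R : rat) fx.
  have [a [b [m [n E]]]] :=
    odd_edge_representation g0 xodd (brick_edges_perm fxQ brick).
  by exists a, b, m, n; apply: brick_representation_perm fx E.
case/or3P: fodd; first exact: reduce.
  by apply: (reduce f2 f1 f3); apply/permP=> P /=; lia.
by apply: (reduce f3 f1 f2); apply/permP=> P /=; lia.
Qed.

Theorem lemma3p1 (e1 e2 e3 : int) (brick : perfect_euler_brick e1 e2 e3) :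
  (exists s : rat, brick_parameter e1 e2 e3 s) /\
  (forall s : rat, brick_parameter e1 e2 e3 s ->
     exists lambda w : rat, on_curve (A_of s) lambda w /\ ~~ degenerate lambda).
Proof.
by split=> [|s]; [exact: brick_parameter_exists | exact: brick_point].
Qed.
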